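(* Let $D\ge 1$ and $r\ge 3$ be integers. For the Hamming graph $H(D,r)$ and for $-D \leq s \leq D$, the subspace $$\sum_{\substack{0 \leq i,j \leq D\\ i+j \geq D \\ j-i =s}}\widetilde{\mathbb{V}}_{ij}$$ is an eigenspace for the matrix $\mathbb{A}_{D}^{-1}\mathbb{A}_{D}^{*-1}\mathbb{A}_{D}\mathbb{A}_{D}^{*}$. The dimension of this eigenspace is $$\sum_{\substack{0 \leq i,j \leq D\\ i+j \geq D \\ j-i =s}}\binom{D}{i}\binom{i}{D-j}(r-2)^{i+j-D}.$$ The corresponding eigenvalue is $(1-r)^s$.
   Context: Let $X$ be a set with $|X|=r$. The Hamming graph $H(D,r)$ has vertex set $\mathbb{X}=X\times\cdots\times X$ ($D$ factors), with two vertices adjacent whenever they differ in precisely one coordinate; it is distance-regular with diameter $D$. Let $\partial$ denote its path-length distance, and let $\mathbb{V}=\mathbb{C}^{\mathbb{X}}$ with Hermitean inner product $\langle u,v\rangle=u^t\overline{v}$. Matrices are complex, with rows and columns indexed by $\mathbb{X}$, and act on $\mathbb{V}$ by left multiplication. For $0\le i\le D$ the $i$th distance matrix $\mathbb{A}_i$ has $(y,z)$-entry $1$ if $\partial(y,z)=i$ and $0$ otherwise. The primitive idempotents $\mathbb{E}_0,\ldots,\mathbb{E}_D$ are taken in the standard $Q$-polynomial ordering: $\mathbb{E}_i$ is the matrix of the orthogonal projection of $\mathbb{V}$ onto the eigenspace of $\mathbb{A}_1$ with eigenvalue $(r-1)D-ri$. Fix $x\in X$ and let $\mathbf{x}=(x,x,\ldots,x)\in\mathbb{X}$.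 For $0\le i\le D$, the $i$th dual idempotent $\mathbb{E}_i^*$ is the diagonal matrix with $(y,y)$-entry $1$ if $\partial(\mathbf{x},y)=i$ and $0$ otherwise, and the $i$th dual distance matrix $\mathbb{A}_i^*$ is the diagonal matrix with $(y,y)$-entry $r^D(\mathbb{E}_i)_{\mathbf{x}y}$. It is known that $\mathbb{A}_D$ and $\mathbb{A}_D^*$ are invertible. For $-1\le i,j\le D$ define $\mathbb{V}_{ij}=(\mathbb{E}_0^*\mathbb{V}+\cdots+\mathbb{E}_i^*\mathbb{V})\cap(\mathbb{E}_0\mathbb{V}+\cdots+\mathbb{E}_j\mathbb{V})$ (so $\mathbb{V}_{ij}=0$ if $i=-1$ or $j=-1$). For $0\le i,j\le D$ let $\widetilde{\mathbb{V}}_{ij}$ be the orthogonal complement of $\mathbb{V}_{i-1,j}+\mathbb{V}_{i,j-1}$ in $\mathbb{V}_{ij}$. *)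

(* Defs.v *)
From HB Require Import structures.
From mathcomp Require Import all_boot all_order all_algebra.
From mathcomp Require Import complex reals.

Set Implicit Arguments.
Unset Strict Implicit.
Unset Printing Implicit Defensive.

Import Order.TTheory GRing.Theory Num.Theory.
Local Open Scope ring_scope.

Definition hdot (C : numClosedFieldType) (n : nat) (u v : 'cV[C]_n) : C :=
  (u^T *m map_mx Num.conj v) 0 0.

Lemma hdot_is_bilinear (C : numClosedFieldType) (n : nat) :
  bilinear_for (GRing.Scale.Law.clone _ _ *%R _)
    (GRing.Scale.Law.clone _ _ (Num.conj \; *%R) _) (@hdot C n).
Proof.
split=> [v a u w|u a v w]; rewrite /hdot.
  by rewrite linearP mulmxDl -scalemxAl !mxE.
by rewrite map_mxD map_mxZ mulmxDr -scalemxAr !mxE.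
Qed.

HB.instance Definition _ (C : numClosedFieldType) (n : nat) :=
  bilinear_isBilinear.Build C _ _ _ _ _ (@hdot C n) (@hdot_is_bilinear C n).

Lemma hdot_is_hermitian (C : numClosedFieldType) (n : nat) (u v : 'cV[C]_n) :
  hdot u v = (-1) ^+ false * Num.conj (hdot v u).
Proof.
rewrite expr0 mul1r /hdot !mxE rmorph_sum; apply: eq_bigr => i _.
by rewrite !mxE rmorphM /= conjCK mulrC.
Qed.

HB.instance Definition _ (C : numClosedFieldType) (n : nat) :=
  @isHermitianSesquilinear.Build C _ false Num.conj (@hdot C n)
    (@hdot_is_hermitian C n).

Definition mxend (C : numClosedFieldType) (n : nat) (M : 'M[C]_n) :
  'End('cV[C]_n) := linfun (mulmx M).

Definition orthoC (C : numClosedFieldType) (n : nat) (U : {vspace 'cV[C]_n}) :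
  {vspace 'cV[C]_n} := orthov (@hdot C n) U.

(* Column q is the image of the q-th standard basis vector under the projection
   onto U along its orthogonal complement. *)
Definition orthoproj (C : numClosedFieldType) (n : nat)
    (U : {vspace 'cV[C]_n}) : 'M[C]_n :=
  \matrix_(p, q) daddv_pi U (orthoC U) (delta_mx q 0) p 0.

Definition walk (T : finType) (e : rel T) (n : nat) (y z : T) : bool :=
  [exists p : n.-tuple T, path e y p && (last y p == z)].

(* Least length of a walk from y to z; the junk value #|T| means that z is not
   reachable from y. *)
Definition gdist (T : finType) (e : rel T) (y z : T) : nat :=
  find (fun n => walk e n y z) (iota 0 #|T|).

Definition vertex (D : nat) (X : finType) : finType := {ffun 'I_D -> X}.

Definition hamming (D : nat) (X : finType) : rel (vertex D X) :=
  fun y z => #|[set k | y k != z k]| == 1%N.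

(* Matrices and vectors indexed by the vertices are indexed by 'I_#|vertex D X|
   through the bijection enum_val. *)
Notation vmatrix C D X := 'M[C]_#|vertex D X|.
Notation vspaceX C D X := {vspace 'cV[C]_#|vertex D X|}.

Definition distmx (C : numClosedFieldType) (D : nat) (X : finType) (i : nat) :
  vmatrix C D X :=
  \matrix_(p, q) (gdist (@hamming D X) (enum_val p) (enum_val q) == i)%:R.

Definition idem (C : numClosedFieldType) (D : nat) (X : finType) (i : nat) :
  vmatrix C D X :=
  orthoproj (passmx.leigenspace (mxend (distmx C D X 1))
               ((#|X|%:R - 1) * D%:R - #|X|%:R * i%:R)).

Definition base (D : nat) (X : finType) (x : X) : vertex D X := [ffun=> x].

Definition dual_idem (C : numClosedFieldType) (D : nat) (X : finType) (x : X)
    (i : nat) : vmatrix C D X :=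
  diag_mx (\row_p (gdist (@hamming D X) (base D x) (enum_val p) == i)%:R).

Definition dual_distmx (C : numClosedFieldType) (D : nat) (X : finType) (x : X)
    (i : nat) : vmatrix C D X :=
  diag_mx (\row_p ((#|X| ^ D)%:R * idem C D X i (enum_rank (base D x)) p)).

(* Integer indices, so that i = -1 and j = -1 give the zero space. *)
Definition Vsub (C : numClosedFieldType) (D : nat) (X : finType) (x : X)
    (i j : int) : vspaceX C D X :=
  ((\sum_(k < D.+1 | (k%:Z <= i)%R) limg (mxend (dual_idem C D x k))) :&:
   (\sum_(k < D.+1 | (k%:Z <= j)%R) limg (mxend (idem C D X k))))%VS.

Definition Vtilde (C : numClosedFieldType) (D : nat) (X : finType) (x : X)
    (i j : int) : vspaceX C D X :=
  (Vsub C D x i j :&: orthoC (Vsub C D x (i - 1) j + Vsub C D x i (j - 1)))%VS.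

(* Main.v *)
(* One-site data decide everything: A_D, A*_D and hence M are D-fold tensor
   powers of operators on C^X.  Fix x1 <> x and take the basis e_x, 1 and
   e_y - e_x1 (y <> x, x1) of C^X.  It consists of eigenvectors of the one-site
   commutator, with eigenvalues 1 - r, (1 - r)^-1 and 1, so the tensors of these
   vectors diagonalise M.  The one-site basis is also adapted to both flags
   <e_x> and <1>, so V_ij is spanned by the basis tensors with at least D - i
   factors e_x and at least D - j factors 1.  The vectors e_y - e_x1 are
   orthogonal to e_x and 1, hence passing to the orthogonal complement keeps
   exactly the tensors with D - i factors e_x and D - j factors 1; these have
   eigenvalue (1 - r)^(j - i), and counting them gives the dimension. *)
Require Import Defs.
From mathcomp Require Import all_boot all_order all_algebra.
From mathcomp Require Import complex reals.
From mathcomp Require Import ring zify.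

Set Implicit Arguments.
Unset Strict Implicit.
Unset Printing Implicit Defensive.

Import Order.TTheory GRing.Theory Num.Theory.
Local Open Scope ring_scope.

(** * Subspaces spanned by columns of an invertible matrix *)

Section ColumnSpan.
Variables (C : numClosedFieldType) (n : nat).
Implicit Types (P Q M F : 'M[C]_n) (S T : pred 'I_n) (u v w : 'cV[C]_n).

Lemma mxendE M v : mxend M v = M *m v.
Proof. by rewrite lfunE. Qed.

Lemma mem_leigenspace M a v :
  (v \in passmx.leigenspace (mxend M) a) = (M *m v == a *: v).
Proof.
by rewrite memv_ker add_lfunE opp_lfunE scale_lfunE id_lfunE mxendE subr_eq0.
Qed.

Lemma mulmx_sum_col P v : P *m v = \sum_i v i 0 *: col i P.
Proof.
apply/matrixP=> i j; rewrite !mxE summxE; apply: eq_bigr => k _.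
by rewrite !mxE mulrC (ord1 j).
Qed.

(** All subspaces of the proof are stored as index sets for one basis matrix, so that sums,
    intersections and dimensions become unions, intersections and cardinalities of these sets. *)
Definition colspan P S : {vspace 'cV[C]_n} := <<[seq col i P | i <- enum S]>>%VS.

Lemma col_colspan P S i : S i -> col i P \in colspan P S.
Proof.
by move=> Si; apply/memv_span/mapP; exists i => //; rewrite mem_enum.
Qed.

Lemma colspan_sub P S (U : {vspace 'cV[C]_n}) :
  (forall i, S i -> col i P \in U) -> (colspan P S <= U)%VS.
Proof.
move=> SU; apply/span_subvP => _ /mapP[i Si ->]; apply: SU.
by rewrite mem_enum in Si.
Qed.

Lemma colspanP P S v : P \in unitmx ->
  reflect (forall i, ~~ S i -> (invmx P *m v) i 0 = 0) (v \in colspan P S).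
Proof.
move=> uP; apply: (iffP idP) => [vS i nSi|v0]; last first.
  rewrite -(mulKVmx uP v) mulmx_sum_col; apply: memv_suml => i _.
  have [Si|/v0->] := boolP (S i); last by rewrite scale0r mem0v.
  exact/memvZ/col_colspan.
(* [K] is the kernel of the [i]-th coordinate in the basis [P], written as a matrix so that its
   kernel is a subspace; it contains every column with index in [S]. *)
pose K := lker (mxend (delta_mx i i *m invmx P)).
suff /subvP/(_ v vS) : (colspan P S <= K)%VS.
  rewrite memv_ker mxendE -mulmxA => /eqP/matrixP/(_ i 0).
  rewrite !mxE (bigD1 i) //= big1 ?addr0.
    by rewrite !mxE !eqxx mul1r.
  by move=> j /negPf ji; rewrite !mxE ji andbF mul0r.
apply: colspan_sub => j Sj; rewrite memv_ker mxendE colE -mulmxA mulKmx //.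
rewrite mul_delta_mx_0 //; apply: contraNneq nSi => ->; exact: Sj.
Qed.

Lemma eq_colspan P S T : S =1 T -> colspan P S = colspan P T.
Proof. by move=> ST; rewrite /colspan (eq_enum ST). Qed.

Lemma colspanI P S T : P \in unitmx ->
  (colspan P S :&: colspan P T)%VS = colspan P (predI S T).
Proof.
move=> uP; apply/vspaceP => v; rewrite memv_cap.
apply/andP/colspanP => // [[/colspanP vS /colspanP vT] i|vST].
  by rewrite negb_and => /orP[/vS|/vT] ->.
by split; apply/colspanP => // i ni; apply: vST; rewrite negb_and ni ?orbT.
Qed.

Lemma colspan_sum P (I : finType) (A : pred I) (S : I -> pred 'I_n) :
  (\sum_(k | A k) colspan P (S k))%VS
    = colspan P (fun i => [exists k, A k && S k i]).
Proof.
apply/eqP; rewrite eqEsubv; apply/andP; split.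
  apply/subv_sumP => k Ak; apply: colspan_sub => i Si.
  by apply: col_colspan; apply/existsP; exists k; rewrite Ak.
apply: colspan_sub => i /existsP[k /andP[Ak Si]].
by apply: (subvP (sumv_sup k Ak (subvv _))); apply: col_colspan.
Qed.

Lemma colspanD P S T : (colspan P S + colspan P T)%VS = colspan P (predU S T).
Proof.
apply/eqP; rewrite eqEsubv subv_add -andbA; apply/and3P; split.
- by apply: colspan_sub => i Si; apply: col_colspan; rewrite /= Si.
- by apply: colspan_sub => i Si; apply: col_colspan; rewrite /= Si orbT.
apply: colspan_sub => i /orP[] Si; apply: subvP (col_colspan P Si).
  exact: addvSl.
exact: addvSr.
Qed.

Lemma dim_colspan P S : P \in unitmx -> \dim (colspan P S) = #|S|.
Proof.
move=> uP.
suff : free [seq col i P | i <- enum S] by move/eqnP; rewrite size_map -cardE.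
have uniqS : uniq (enum S) by exact: enum_uniq.
elim: (enum S) uniqS => [|i s IH] /=; first by rewrite nil_free.
case/andP=> si us; rewrite free_cons IH // andbT; apply: contra si => Pi.
(* A column in the span of the remaining ones would have [i]-th coordinate 0, whereas that
   coordinate is 1. *)
have {}Pi : col i P \in colspan P (mem s).
  apply: subvP Pi; apply/span_subvP => _ /mapP[j sj ->].
  exact: (col_colspan P (S := mem s)).
apply: contraT => si; move/colspanP: Pi => /(_ uP i si).
rewrite colE mulKmx // mxE !eqxx => /eqP; by rewrite oner_eq0.
Qed.

Lemma leigenspace_diag M P (d : 'rV[C]_n) a : P \in unitmx ->
  M *m P = P *m diag_mx d ->
  passmx.leigenspace (mxend M) a = colspan P (fun i => d 0 i == a).
Proof.
move=> uP MP; apply/vspaceP => v; rewrite mem_leigenspace.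
rewrite -(mulKVmx uP v); move: (invmx P *m v) => w.
rewrite mulmxA MP -mulmxA scalemxAr; apply/eqP/colspanP => // [|wS].
  move/(congr1 (mulmx (invmx P))); rewrite !mulKmx // => /matrixP dw i di.
  apply/eqP; have /eqP := dw i 0; rewrite mul_diag_mx !mxE -subr_eq0 -mulrBl.
  by rewrite mulf_eq0 subr_eq0 (negPf di).
congr (_ *m _); apply/matrixP => i j; rewrite mul_diag_mx !mxE (ord1 j).
have [->//|di] := eqVneq (d 0 i) a.
by have := wS i di; rewrite mulKmx // => ->; rewrite !mulr0.
Qed.

(** Column [i] of [invmx P *m Q] holds the coordinates of [col i Q] in the basis [P], so only the
    support of the transition matrix matters. *)
Lemma colspan_change P Q S : P \in unitmx ->
  (forall i j, S i -> (invmx P *m Q) j i != 0 -> S j) ->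
  (colspan Q S <= colspan P S)%VS.
Proof.
move=> uP PQ; apply: colspan_sub => i Si; apply/colspanP => // j nSj.
have -> : (invmx P *m col i Q) j 0 = (invmx P *m Q) j i.
  by rewrite !mxE; apply: eq_bigr => k _; rewrite !mxE.
by apply/eqP; apply: contraNT nSj; apply: PQ.
Qed.

(** * Orthogonal complements and orthogonal projections *)

Lemma hdot_eq0 v : hdot v v = 0 -> v = 0.
Proof.
rewrite /hdot mxE => /eqP; rewrite psumr_eq0 => [/allP v0|i _]; last first.
  by rewrite !mxE mul_conjC_ge0.
apply/matrixP => i j; rewrite (ord1 j) mxE.
have := v0 i (mem_index_enum _); rewrite !mxE.
by rewrite mul_conjC_eq0 => /eqP.
Qed.

Lemma hdot_mulmx M u v :
  hdot (M *m u) v = hdot u ((map_mx Num.conj M)^T *m v).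
Proof.
rewrite /hdot trmx_mul map_mxM mulmxA; congr ((_ *m _ *m _) 0 0).
by apply/matrixP => i j; rewrite !mxE; symmetry; apply: conjCK.
Qed.

Lemma hdot_col P i j :
  hdot (col i P) (col j P) = (P^T *m map_mx Num.conj P) i j.
Proof. by rewrite /hdot !mxE; apply: eq_bigr => k _; rewrite !mxE. Qed.

Lemma mem_orthoC (U : {vspace 'cV[C]_n}) v :
  reflect {in U, forall w, hdot v w = 0} (v \in orthoC U).
Proof. exact: mem_orthovP. Qed.

Lemma capv_orthoC (U : {vspace 'cV[C]_n}) : (U :&: orthoC U = 0)%VS.
Proof.
apply/eqP; rewrite -subv0; apply/subvP => v.
rewrite memv_cap memv0 => /andP[Uv /mem_orthoC/(_ _ Uv)].
by move/hdot_eq0/eqP.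
Qed.

Lemma colspan_orthoC P S v :
  (v \in orthoC (colspan P S)) = [forall i, S i ==> (hdot v (col i P) == 0)].
Proof.
apply/mem_orthoC/'forall_implyP => [vS i Si|vS w /coord_span->].
  by apply/eqP/vS/col_colspan.
rewrite linear_sumr big1 // => i _; rewrite linearZ /=.
have /mapP[j Sj ->] :
    [seq col i P | i <- enum S]`_i \in [seq col i P | i <- enum S].
  by apply: mem_nth; rewrite size_map -cardE ltn_ord.
rewrite mem_enum in Sj.
by rewrite (eqP (vS j Sj)) mulr0.
Qed.

(** Split a vector of the span of [T] into its part over [S] and its part over the rest. These parts
    are orthogonal, so if the vector is orthogonal to the span of the rest, its second part is
    orthogonal to itself and vanishes. *)
Lemma colspan_orthoD P S T : subpred S T ->
  (forall i j, S i -> T j -> ~~ S j -> hdot (col i P) (col j P) = 0) ->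
  (colspan P T :&: orthoC (colspan P (predD T S)))%VS = colspan P S.
Proof.
move=> ST orthoST; apply/eqP; rewrite eqEsubv; apply/andP; split.
  apply/subvP => v; rewrite memv_cap => /andP[].
  have -> : colspan P T = (colspan P S + colspan P (predD T S))%VS.
    rewrite colspanD; apply: eq_colspan => i /=.
    by case: (boolP (S i)) => // /ST.
  case/memv_addP => u Su [w Tw ->] vo.
  suff /eqP: w = 0 by rewrite -memv0 memv0 => /eqP->; rewrite addr0.
  apply/eqP; rewrite -memv0 -(capv_orthoC (colspan P (predD T S))) memv_cap Tw.
  rewrite -(addKr u w) addrC rpredB //.
  apply: subvP Su; apply: colspan_sub => i Si; rewrite colspan_orthoC.
  by apply/'forall_implyP => j /andP[nSj Tj]; rewrite orthoST.
rewrite subv_cap; apply/andP; split; apply: colspan_sub => i Si.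
  by apply: col_colspan; apply: ST.
rewrite colspan_orthoC.
by apply/'forall_implyP => j /andP[nSj Tj]; rewrite orthoST.
Qed.

Lemma orthoprojE (U : {vspace 'cV[C]_n}) v :
  orthoproj U *m v = daddv_pi U (orthoC U) v.
Proof.
rewrite mulmx_sum_col [in RHS](_ : v = \sum_i v i 0 *: delta_mx i 0).
  rewrite linear_sum; apply: eq_bigr => i _; rewrite linearZ /=; congr (_ *: _).
  by apply/matrixP => j k; rewrite !mxE (ord1 k).
rewrite [LHS]matrix_sum_delta; apply: eq_bigr => i _.
by rewrite big_ord1.
Qed.

Lemma limg_orthoproj (U : {vspace 'cV[C]_n}) :
  limg (mxend (orthoproj U)) = U.
Proof.
apply/eqP; rewrite eqEsubv; apply/andP; split; apply/subvP => v.
  by case/memv_imgP => u _ ->; rewrite mxendE orthoprojE memv_pi.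
move=> Uv; apply/memv_imgP; exists v; first exact: memvf.
by rewrite mxendE orthoprojE daddv_pi_id // capv_orthoC.
Qed.

(** A Hermitian idempotent is the orthogonal projection onto its image: [v - F *m v] is orthogonal
    to the fixed vectors because [F] is self-adjoint. *)
Lemma orthoproj_leigenspace F : F *m F = F -> F^T = map_mx Num.conj F ->
  orthoproj (passmx.leigenspace (mxend F) 1) = F.
Proof.
move=> FF FT; set U := passmx.leigenspace _ _.
have UF v : F *m v \in U by rewrite mem_leigenspace mulmxA FF scale1r.
(* On the complement the complementary projection is the identity, and the two projections add up to
   [w], so the first one gives 0. *)
have pi0 w : w \in orthoC U -> daddv_pi U (orthoC U) w = 0.
  move=> Uw; have UI := capv_orthoC U.
  have IU : (orthoC U :&: U = 0)%VS by rewrite capvC.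
  have := daddv_pi_add UI (subvP (addvSr U (orthoC U)) w Uw).
  by rewrite (daddv_pi_id IU Uw) => pw; apply: (addIr w); rewrite add0r.
apply/matrixP => p q; rewrite mxE.
set v := delta_mx q 0.
have vF : v - F *m v \in orthoC U.
  apply/mem_orthoC => w; rewrite mem_leigenspace scale1r => /eqP Fw.
  rewrite linearBl /= hdot_mulmx -FT trmxK Fw; exact: subrr.
rewrite -[X in daddv_pi _ _ X](subrK (F *m v)) linearD /= (pi0 _ vF) add0r.
by rewrite (daddv_pi_id (capv_orthoC U) (UF v)) -colE mxE.
Qed.

End ColumnSpan.

(** * Path length in the Hamming graph counts differing coordinates *)

Section HammingDistance.
Variables (D : nat) (X : finType).
Implicit Types y z : vertex D X.

Definition hamdist y z : nat := #|[set k | y k != z k]|.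

Lemma hamdist_leq y z : (hamdist y z <= D)%N.
Proof. by rewrite -[X in (_ <= X)%N]card_ord max_card. Qed.

Lemma hamdist_triangle y1 y2 y3 :
  (hamdist y1 y3 <= hamdist y1 y2 + hamdist y2 y3)%N.
Proof.
rewrite /hamdist -cardsUI; apply: leq_trans (leq_addr _ _).
apply/subset_leq_card/subsetP => k; rewrite !inE -negb_and.
by apply: contraNN => /andP[/eqP-> /eqP->].
Qed.

Lemma path_hamdist y p :
  path (@hamming D X) y p -> (hamdist y (last y p) <= size p)%N.
Proof.
elim: p y => [|y' p IH] y /=.
  by rewrite leqn0 cards_eq0 => _; apply/eqP/setP => k; rewrite !inE eqxx.
case/andP=> /eqP yy' /IH; rewrite -ltnS; apply: leq_trans.
by rewrite -addn1 addnC -yy'; apply: hamdist_triangle.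
Qed.

Lemma hamdist_path n y z : hamdist y z = n ->
  exists2 p, size p = n & path (@hamming D X) y p && (last y p == z).
Proof.
elim: n y => [|n IH] y dyz.
  exists [::] => //=; apply/eqP/ffunP => k.
  have /setP/(_ k) : [set k | y k != z k] = set0 by apply: cards0_eq.
  by rewrite !inE => /negbFE/eqP.
have /card_gt0P[k] : (0 < hamdist y z)%N by rewrite dyz.
rewrite inE => ykz.
(* A first step towards [z]: correct one coordinate [k] in which [y] and [z] differ. *)
pose y' : vertex D X := [ffun l => if l == k then z k else y l].
have [|p sp /andP[py' ly']] := IH y'.
  apply/eqP; rewrite -eqSS -dyz /hamdist (cardsD1 k [set k | y k != z k]).
  rewrite inE ykz add1n eqSS; apply/eqP; congr #|pred_of_set _|.
  by apply/setP => l; rewrite !inE ffunE; case: (eqVneq l k) => [->|]; rewrite ?eqxx.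
exists (y' :: p); rewrite /= ?sp // py' ly' !andbT.
apply/cards1P; exists k; apply/setP => l; rewrite !inE ffunE.
by case: (eqVneq l k) => [->|]; rewrite ?eqxx.
Qed.

Lemma gdist_hamming y z : (1 < #|X|)%N ->
  gdist (@hamming D X) y z = hamdist y z.
Proof.
move=> X1; rewrite /gdist.
(* Since [D < #|X| ^ D], the search range in [gdist] contains the distance and the junk value is
   never returned. *)
have dlt : (hamdist y z < #|vertex D X|)%N.
  by rewrite card_ffun card_ord (leq_ltn_trans (hamdist_leq y z)) // ltn_expl.
rewrite -(subnKC dlt) addSnnS iotaD find_cat ifN; last first.
  apply/hasPn => n; rewrite mem_iota add0n => /= n_lt.
  apply/existsP => -[p /andP[yp /eqP pz]].
  by have := path_hamdist yp; rewrite size_tuple pz leqNgt n_lt.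
rewrite size_iota add0n /= ifT ?addn0 //.
have [p sp yp] := hamdist_path (erefl (hamdist y z)).
apply/existsP; exists (Tuple (introT eqP sp)); exact: yp.
Qed.

End HammingDistance.

(** * Tensor products of one-site matrices *)

Section Tensor.
Variables (C : numClosedFieldType) (D : nat) (X : finType).
Implicit Types (K L : 'I_D -> X -> X -> C) (k : 'I_D).
Local Notation N := #|vertex D X|.
Local Notation entry p k := ((enum_val p : vertex D X) k).

(** One-site matrices are plain functions on [X], which avoids a second enumeration besides that of
    the vertices. *)
Definition kmul (K L : X -> X -> C) (a c : X) : C := \sum_b K a b * L b c.

Definition kdiag (m : X -> C) (a b : X) : C := (a == b)%:R * m b.

Lemma kmul_diagl m (L : X -> X -> C) a c : kmul (kdiag m) L a c = m a * L a c.
Proof.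
rewrite /kmul (bigD1 a) //= big1 ?addr0 => [|b /negPf ba].
  by rewrite /kdiag eqxx mul1r.
by rewrite /kdiag eq_sym ba !mul0r.
Qed.

Lemma kmul_diagr m (L : X -> X -> C) a c : kmul L (kdiag m) a c = L a c * m c.
Proof.
rewrite /kmul (bigD1 c) //= big1 ?addr0 => [|b /negPf ba].
  by rewrite /kdiag eqxx mul1r.
by rewrite /kdiag ba mul0r mulr0.
Qed.

Lemma prodr_bool (b : pred 'I_D) :
  \prod_k (b k)%:R = [forall k, b k]%:R :> C.
Proof.
have [/forallP b1|/forallPn[k /negPf bk]] := boolP [forall k, b k].
  by rewrite big1 // => k _; rewrite b1.
by rewrite (bigD1 k) //= bk mul0r.
Qed.

Definition tens K : vmatrix C D X :=
  \matrix_(p, q) \prod_k K k (entry p k) (entry q k).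


Lemma eq_tens K L : (forall k, K k =2 L k) -> tens K = tens L.
Proof.
move=> KL; apply/matrixP => p q; rewrite !mxE.
by apply: eq_bigr => k _; rewrite KL.
Qed.

(** A sum over all vertices of products over the sites is the product over the sites of sums over
    [X], by distributivity. *)
Lemma tens_mul K L : tens K *m tens L = tens (fun k => kmul (K k) (L k)).
Proof.
apply/matrixP => p q; rewrite !mxE.
rewrite (bigA_distr_bigA (fun k b => K k (entry p k) b * L k b (entry q k))).
rewrite (reindex (fun p : 'I_N => enum_val p : {ffun 'I_D -> X})) /=; last first.
  exact/onW_bij/enum_val_bij.
by apply: eq_bigr => i _; rewrite !mxE big_split.
Qed.

Lemma tens_kdiag m :
  tens (fun k => kdiag (m k)) = diag_mx (\row_p \prod_k m k (entry p k)).
Proof.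
apply/matrixP => p q; rewrite !mxE big_split /=.
rewrite (prodr_bool (fun k => entry p k == entry q k)).
have -> : [forall k, entry p k == entry q k] = (p == q).
  apply/'forall_eqP/eqP => [pq|-> //]; apply/enum_val_inj/ffunP => k.
  exact: pq.
have [->|] := eqVneq p q; first by rewrite mul1r mulr1n.
by rewrite mul0r mulr0n.
Qed.

Lemma tens_kdiag1 : tens (fun k => kdiag (fun=> 1)) = 1%:M.
Proof.
rewrite tens_kdiag -diag_const_mx; congr diag_mx.
by apply/rowP => p; rewrite !mxE big1.
Qed.

Lemma tens_inverse K L : (forall k, kmul (K k) (L k) =2 kdiag (fun=> 1)) ->
  [/\ tens L \in unitmx, tens K \in unitmx & invmx (tens L) = tens K].
Proof.
move=> KL; have KL1 : tens K *m tens L = 1%:M.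
  by rewrite tens_mul (eq_tens KL) tens_kdiag1.
have [uK uL] := mulmx1_unit KL1; split=> //.
by rewrite -[RHS]mulmx1 -(mulmxV uL) mulmxA KL1 mul1mx.
Qed.

Lemma tens_eigen K L m : (forall k a b, kmul (K k) (L k) a b = L k a b * m b) ->
  tens K *m tens L = tens L *m diag_mx (\row_p \prod_k m (entry p k)).
Proof.
move=> KLm; rewrite -(tens_kdiag (fun=> m)) !tens_mul; apply: eq_tens => k a b.
by rewrite KLm kmul_diagr.
Qed.

Lemma tens_tr K : (tens K)^T = tens (fun k a b => K k b a).
Proof. by apply/matrixP => p q; rewrite !mxE. Qed.

Lemma tens_conj K : map_mx Num.conj (tens K) = tens (fun k a b => (K k a b)^*).
Proof. by apply/matrixP => p q; rewrite !mxE rmorph_prod. Qed.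

(** When [p] labels a basis tensor, this is [D] minus the number of its factors of type [c]. With
    [c = x] it is the index [i] of the flag, with [c = x1] the index [j]. *)
Definition ndiff (c : X) (p : 'I_N) : nat := #|[set k | entry p k != c]|.

Lemma ndiff_leq c p : (ndiff c p <= D)%N.
Proof. by rewrite -[X in (_ <= X)%N]card_ord max_card. Qed.

(* The transition matrix between the two tensor bases only has nonzero entries
   (g, f) with g k = c whenever f k = c, because the one-site bases agree at c. *)
Lemma colspan_flag (B iB B' iB' : X -> X -> C) (c : X) (S : pred nat) :
    kmul iB B =2 kdiag (fun=> 1) -> kmul iB' B' =2 kdiag (fun=> 1) ->
    (forall a, B a c = B' a c) -> (forall m n, (m <= n)%N -> S n -> S m) ->
  colspan (tens (fun=> B)) (fun p => S (ndiff c p))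
    = colspan (tens (fun=> B')) (fun p => S (ndiff c p)).
Proof.
have sub (B1 iB1 B2 iB2 : X -> X -> C) :
    kmul iB1 B1 =2 kdiag (fun=> 1) -> (forall a, B1 a c = B2 a c) ->
    (forall m n, (m <= n)%N -> S n -> S m) ->
    (colspan (tens (fun=> B2)) (fun p => S (ndiff c p))
     <= colspan (tens (fun=> B1)) (fun p => S (ndiff c p)))%VS.
  move=> iB1B1 B12 downS.
  have [uB1 _ invB1] := tens_inverse (fun _ : 'I_D => iB1B1).
  apply: colspan_change => // i j Si; rewrite invB1 tens_mul mxE => /prodf_neq0 nz.
  apply: downS Si; apply/subset_leq_card/subsetP => k; rewrite !inE.
  apply: contraNN => /eqP ik; have := nz k isT; rewrite ik.
  rewrite (_ : kmul _ _ _ _ = kmul iB1 B1 (entry j k) c).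
    by rewrite iB1B1 /kdiag mulr1 pnatr_eq0 eqb0 negbK.
  by apply: eq_bigr => b _; rewrite B12.
move=> iBB iBB' BB' downS; apply/eqP; rewrite eqEsubv; apply/andP; split.
  exact: (sub _ _ _ iB iBB').
exact: (sub _ _ _ iB' iBB).
Qed.

End Tensor.

(** * One-site bases and operators *)

Section Site.
Variables (C : numClosedFieldType) (X : finType).
Implicit Types (f t : X -> C) (a b c y z : X).
Local Notation r := (#|X|%:R : C).

Lemma sum_delta f c : \sum_b f b * (b == c)%:R = f c.
Proof.
rewrite (bigD1 c) //= big1 ?addr0 ?eqxx ?mulr1 // => b /negPf->.
by rewrite mulr0.
Qed.

Lemma sum_delta1 c : \sum_b (b == c)%:R = 1 :> C.
Proof. by rewrite -[RHS](sum_delta (fun=> 1) c); apply: eq_bigr => b _; rewrite mul1r. Qed.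

Lemma sum_1 : \sum_(b : X) 1 = r.
Proof. by rewrite sumr_const. Qed.

(* Column y0 is the all-ones vector and column y <> y0 is e_y - t y * e_y0, which
   is orthogonal to t when t y0 = 1. *)
Definition site t y0 (z y : X) : C :=
  if y == y0 then 1 else (z == y)%:R - t y * (z == y0)%:R.

Lemma sum_site t y0 f y : \sum_z f z * site t y0 z y =
  if y == y0 then \sum_z f z else f y - t y * f y0.
Proof.
rewrite /site; case: eqP => _; first by apply: eq_bigr => z _; rewrite mulr1.
rewrite -[f y](sum_delta f) -[f y0](sum_delta f) mulr_sumr -sumrB.
by apply: eq_bigr => z _; ring.
Qed.

(** The functional [u] is 1 on the all-ones vector and kills the other columns, so it reads off the
    coefficient of the all-ones column. Subtracting that coefficient from entry [y] leaves the
    coordinate at [y <> y0]. *)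
Lemma site_inv t y0 : t y0 = 1 -> \sum_z t z != 0 ->
  let u z := t z / \sum_z t z in
  kmul (fun y z => if y == y0 then u z else (y == z)%:R - u z) (site t y0)
    =2 kdiag (fun=> 1).
Proof.
move=> t0 st u y w; rewrite /kmul /kdiag sum_site mulr1.
have su : \sum_z u z = 1 by rewrite -mulr_suml divff.
have [->|wy0] := eqVneq w y0.
  have [//|ny] := eqVneq y y0.
  rewrite sumrB su; under eq_bigr do rewrite eq_sym.
  by rewrite sum_delta1 subrr.
have [->|ny] := eqVneq y y0.
  by rewrite /u t0 eq_sym (negPf wy0) /=; field.
by rewrite /u t0 /=; field.
Qed.

(** This is J - I, with J the all-ones matrix. Vertices at distance [D] differ in every coordinate,
    so its tensor power is the [D]-th distance matrix. *)
Definition neighbor a b : C := (a != b)%:R.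

Lemma sum_neighbor f a : \sum_b neighbor a b * f b = \sum_b f b - f a.
Proof.
rewrite -[f a](sum_delta f) -sumrB; apply: eq_bigr => b _.
by rewrite /neighbor eq_sym; case: (b == a) => /=; ring.
Qed.

Lemma kmul_neighbor K a c : kmul neighbor K a c = \sum_b K b c - K a c.
Proof. exact: (sum_neighbor (K^~ c)). Qed.

(** As J^2 = r J, the inverse of J - I is J / (r - 1) - I. *)
Lemma neighbor_inv : r != 1 ->
  kmul (fun a b => (r - 1)^-1 - (a == b)%:R) neighbor =2 kdiag (fun=> 1).
Proof.
move=> r1; have r10 : r - 1 != 0 by rewrite subr_eq0.
move=> a c; rewrite /kmul /kdiag mulr1.
under eq_bigr => b do rewrite mulrC [neighbor b c]/neighbor (eq_sym b c) -/(neighbor c b).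
rewrite (sum_neighbor (fun b => (r - 1)^-1 - (a == b)%:R) c).
under eq_bigr do rewrite eq_sym.
rewrite sumrB sum_delta1 sumr_const -mulr_natl -[#|_|%:R]/r.
by field.
Qed.

(* One-site projection onto the complement of the all-ones vector. *)
Definition cosite a b : C := (a == b)%:R - r^-1.

Lemma cosite_site y0 a y : r != 0 ->
  kmul cosite (site (fun=> 1) y0) a y = site (fun=> 1) y0 a y * (y != y0)%:R.
Proof.
move=> r0; rewrite /kmul sum_site /site /cosite.
case: eqP => _ /=; last by ring.
rewrite sumrB sumr_const; under eq_bigr do rewrite eq_sym.
by rewrite sum_delta1 -[_ *+ #|_|]mulr_natl divff // subrr mulr0.
Qed.

Lemma cosite_idem : r != 0 -> kmul cosite cosite =2 cosite.
Proof.
move=> r0 a c; rewrite /kmul /cosite.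
under eq_bigr do rewrite mulrBr.
rewrite sumrB sum_delta -mulr_suml sumrB sumr_const.
under eq_bigr do rewrite eq_sym.
by rewrite sum_delta1 -[_ *+ #|_|]mulr_natl divff // subrr mul0r subr0.
Qed.

Lemma neighbor_site y0 a y :
  \sum_b neighbor a b * site (fun=> 1) y0 b y
    = site (fun=> 1) y0 a y * (if y == y0 then r - 1 else - 1).
Proof.
rewrite sum_neighbor /site; case: eqP => _; first by rewrite sum_1 mul1r.
rewrite sumrB sum_delta1; under eq_bigr do rewrite mul1r.
by rewrite sum_delta1; ring.
Qed.

(* Diagonal of the one-site dual distance matrix. *)
Definition dualsite x b : C := r * (x == b)%:R - 1.

Definition site_eigenvalue x x1 y : C :=
  if y == x then 1 - r else if y == x1 then (1 - r)^-1 else 1.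

(** The eigenvector equation of the one-site commutator with its inverses cleared:
    [A As B = As A B L], with [L] the diagonal matrix of eigenvalues. Since [A] is J - I, both sides
    reduce to column sums and single entries, compared for the columns [x1], [x] and the others. *)
Lemma commutator_site x x1 a y : x1 != x -> r != 1 ->
  let B := site (fun z => (z != x)%:R) x1 in
  kmul neighbor (kmul (kdiag (dualsite x)) B) a y =
  kmul (kdiag (dualsite x))
    (kmul neighbor (kmul B (kdiag (site_eigenvalue x x1)))) a y.
Proof.
move=> x1x r1 B; have r10 : 1 - r != 0 by rewrite subr_eq0 eq_sym.
(* Hence J kills the dual diagonal, and on the all-ones column the two sides differ by the factor -1
   / (r - 1). *)
have sum_dual : \sum_b dualsite x b = 0.
  rewrite sumrB sum_1 -mulr_sumr; under eq_bigr do rewrite eq_sym.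
  by rewrite sum_delta1 mulr1 subrr.
rewrite kmul_diagl !kmul_neighbor kmul_diagl kmul_diagr.
under eq_bigr do rewrite kmul_diagl.
under [in RHS]eq_bigr do rewrite kmul_diagr -(mul1r (B _ _)).
rewrite -mulr_suml !sum_site sum_dual sum_1 /B /site /site_eigenvalue /dualsite.
have [->|yx1] := eqVneq y x1; first by rewrite (negPf x1x); field.
rewrite (eq_sym x x1) (negPf x1x).
have [->|yx] := eqVneq y x.
  by rewrite (eq_sym x a); case: (a == x) => /=; ring.
rewrite (eq_sym x a).
have [->|_] := eqVneq a x; last by ring.
by rewrite (eq_sym x y) (eq_sym x x1) (negPf yx) (negPf x1x) /=; ring.
Qed.

End Site.

(** Applied to 1 - r, of norm r - 1 > 1: distinct exponents give distinct eigenvalues, so no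
    eigenspace mixes two values of j - i. *)
Lemma exprz_inj (F : numFieldType) (a : F) : 1 < `|a| -> injective (exprz a).
Proof.
move=> a1; have a0 : a != 0 by rewrite -normr_gt0 (lt_trans _ a1).
have exprn1 (k : nat) : a ^+ k = 1 -> k = 0%N.
  move/(congr1 Num.norm)/eqP; rewrite normrX normr1 ieexprn_weq1 ?normr_ge0 //.
  by rewrite (gt_eqF a1) orbF => /eqP.
have expz1 (k : int) : a ^ k = 1 -> k = 0.
  case: k => k; first by rewrite -exprnP => /exprn1->.
  by rewrite NegzE -exprnN => /eqP; rewrite invr_eq1 => /eqP/exprn1.
move=> m n amn; apply/eqP; rewrite -subr_eq0; apply/eqP/expz1.
by rewrite expfzDr // amn -expfzDr // subrr.
Qed.

(** * The matrices of the Hamming graph as tensors *)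

Section HammingGraph.
Variables (C : numClosedFieldType) (D : nat) (X : finType) (x x1 : X).
Hypotheses (X3 : (2 < #|X|)%N) (x1x : x1 != x).
Local Notation N := #|vertex D X|.
Local Notation r := (#|X|%:R : C).
Local Notation tensn K := (@tens C D X (fun=> K)).
(** In both bases label [x1] stands for the all-ones vector. In [eigB] every other label [y] gives
    e_y - e_x1, an eigenvector of J - I; [flagB] differs only at label [x], where it has e_x. *)
Local Notation eigB := (site (C := C) (fun=> 1) x1).
Local Notation flagB := (site (C := C) (fun z => (z != x)%:R) x1).
Local Notation entry p k := ((enum_val p : vertex D X) k).
Implicit Types p q : 'I_N.

Lemma card_neq0 : r != 0.
Proof. by rewrite pnatr_eq0; lia. Qed.

Lemma card_neq1 : r != 1.
Proof. by rewrite pnatr_eq1; lia. Qed.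

Lemma distmxE i : distmx C D X i =
  \matrix_(p, q) (hamdist (enum_val p) (enum_val q) == i)%:R.
Proof. by apply/matrixP => p q; rewrite !mxE gdist_hamming //; lia. Qed.

Lemma distmx_diameter : distmx C D X D = tensn (@neighbor C X).
Proof.
rewrite distmxE; apply/matrixP => p q; rewrite !mxE.
rewrite (prodr_bool C (fun k => entry p k != entry q k)); congr (_%:R).
rewrite -[X in _ == X]card_ord; congr nat_of_bool.
apply/eqP/forallP => [pq k|pq].
  have /subset_cardP : #|[set k | entry p k != entry q k]| = #|'I_D| by [].
  by move/(_ (subset_predT _))/(_ k); rewrite !inE.
by apply: eq_card => k; rewrite !inE pq.
Qed.

(** Adjacency means that the set of differing coordinates is some singleton {k}. The indicator of
    this is a product over the sites: differ at [k], agree elsewhere. *)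
Lemma distmx1E : distmx C D X 1 = \sum_(k < D)
  tens (fun l => if l == k then @neighbor C X else kdiag (fun=> 1)).
Proof.
rewrite distmxE; apply/matrixP => p q; rewrite summxE !mxE.
set S := [set k | entry p k != entry q k].
transitivity (\sum_(k < D) (S == [set k])%:R : C).
  have [S1|S1] := boolP (hamdist (enum_val p) (enum_val q) == 1%N).
    have /cards1P[k0 ->] : #|S| == 1%N by [].
    rewrite (bigD1 k0) //= eqxx big1 ?addr0 // => k kk0.
    by rewrite (inj_eq set1_inj) eq_sym (negPf kk0).
  rewrite big1 // => k _; have [Sk|//] := eqVneq S [set k].
  by rewrite /hamdist -/S Sk cards1 in S1.
apply: eq_bigr => k _; rewrite mxE.
transitivity (\prod_l ((l \in S) == (l == k))%:R : C).
  rewrite (prodr_bool C (fun l => (l \in S) == (l == k))); congr (_%:R).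
  congr nat_of_bool; apply/eqP/'forall_eqP => [-> l|Sk]; first by rewrite inE.
  by apply/setP => l; rewrite Sk inE.
apply: eq_bigr => l _; rewrite inE; case: (l == k).
  by rewrite eqb_id.
by rewrite /kdiag mulr1 eqbF_neg negbK.
Qed.

(** Each site contributes r - 1 if its label is [x1] and -1 otherwise. *)
Lemma distmx1_eigen : distmx C D X 1 *m tensn eigB =
  tensn eigB *m diag_mx (\row_p ((r - 1) * D%:R - r * (ndiff x1 p)%:R)).
Proof.
rewrite distmx1E mulmx_suml; apply/matrixP => p q.
rewrite summxE mul_mx_diag !mxE.
transitivity (\sum_(k < D) (\prod_l eigB (entry p l) (entry q l)) *
    (if entry q k == x1 then r - 1 else - 1)).
  apply: eq_bigr => k _; rewrite tens_mul mxE (bigD1 k) //= eqxx.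
  rewrite [in RHS](bigD1 k) //= -mulrA [_ * (if _ then _ else _)]mulrC mulrA.
  rewrite [kmul _ _ _ _]neighbor_site; congr (_ * _).
  by apply: eq_bigr => l /negPf->; rewrite kmul_diagl mul1r.
rewrite -mulr_sumr; congr (_ * _).
transitivity (\sum_(k < D) ((r - 1) - r * (entry q k != x1)%:R)).
  by apply: eq_bigr => k _; case: eqP => _ /=; ring.
rewrite sumrB sumr_const card_ord -mulr_sumr mulr_natr; congr (_ - _ * _).
by rewrite -natr_sum /ndiff -sum1dep_card [in RHS]big_mkcond.
Qed.

Lemma eigB_inv : exists iB, kmul iB eigB =2 kdiag (fun=> 1).
Proof.
eexists; apply: site_inv => //; rewrite sum_1; exact: card_neq0.
Qed.

Lemma flagB_inv : exists iB, kmul iB flagB =2 kdiag (fun=> 1).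
Proof.
eexists; apply: site_inv => //; first by rewrite x1x.
by rewrite (bigD1 x1) //= x1x gt_eqF // ltr_pwDl // sumr_ge0 //.
Qed.

Lemma flagB_unit : tensn flagB \in unitmx.
Proof.
have [iB iBB] := flagB_inv.
by have [] := tens_inverse (fun _ : 'I_D => iBB).
Qed.

Lemma eigB_unit : tensn eigB \in unitmx.
Proof.
have [iB iBB] := eigB_inv.
by have [] := tens_inverse (fun _ : 'I_D => iBB).
Qed.

Lemma eigenspace_distmx1 k :
  passmx.leigenspace (mxend (distmx C D X 1)) ((r - 1) * D%:R - r * k%:R)
    = colspan (tensn eigB) (fun p => ndiff x1 p == k).
Proof.
rewrite (leigenspace_diag _ eigB_unit distmx1_eigen).
apply: eq_colspan => p; rewrite mxE (inj_eq (addrI _)) eqr_opp.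
by rewrite (inj_eq (mulfI card_neq0)) eqr_nat.
Qed.

Lemma limg_idem k :
  limg (mxend (idem C D X k)) = colspan (tensn eigB) (fun p => ndiff x1 p == k).
Proof. by rewrite limg_orthoproj eigenspace_distmx1. Qed.

(** The tensor power of [cosite] is a Hermitian idempotent. It fixes exactly the span of the [eigB]
    tensors without all-ones factor, which is the eigenspace of index [D]. *)
Lemma idem_diameter : idem C D X D = tensn (@cosite C X).
Proof.
rewrite /idem -[RHS]orthoproj_leigenspace; first 1 last.
- by rewrite tens_mul; apply: eq_tens => k; apply/cosite_idem/card_neq0.
- rewrite tens_tr tens_conj; apply: eq_tens => k a b; rewrite /cosite.
  by rewrite rmorphB fmorphV !rmorph_nat eq_sym.
congr orthoproj; rewrite eigenspace_distmx1.
have cosite_eig := tens_eigen (fun (_ : 'I_D) a b => cosite_site x1 a b card_neq0).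
rewrite (leigenspace_diag _ eigB_unit cosite_eig).
apply: eq_colspan => p; rewrite mxE.
rewrite (prodr_bool C (fun k => entry p k != x1)) pnatr_eq1 eqb1.
apply/eqP/forallP => [pD k|pD].
  have /subset_cardP : #|[set k | entry p k != x1]| = #|'I_D| by rewrite card_ord.
  by move/(_ (subset_predT _))/(_ k); rewrite !inE.
by rewrite -[RHS]card_ord; apply: eq_card => k; rewrite !inE pD.
Qed.

Lemma hamdist_base p : hamdist (base D x) (enum_val p) = ndiff x p.
Proof. by apply: eq_card => k; rewrite !inE ffunE eq_sym. Qed.

Lemma dual_distmx_diameter :
  dual_distmx C D x D = tensn (kdiag (dualsite C x)).
Proof.
rewrite tens_kdiag /dual_distmx idem_diameter; congr diag_mx; apply/rowP => p.
rewrite !mxE enum_rankK natrX -[X in _ ^+ X]card_ord.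
rewrite -prodr_const -big_split /=; apply: eq_bigr => k _.
by rewrite ffunE /cosite /dualsite mulrBr divff // card_neq0.
Qed.

Lemma limg_dual_idem k :
  limg (mxend (dual_idem C D x k)) = colspan 1%:M (fun p => ndiff x p == k).
Proof.
have dual_idemE v p : (dual_idem C D x k *m v) p 0 = (ndiff x p == k)%:R * v p 0.
  by rewrite mul_diag_mx !mxE gdist_hamming ?hamdist_base //; lia.
apply/eqP; rewrite eqEsubv; apply/andP; split.
  apply/subvP => _ /memv_imgP[v _ ->]; apply/colspanP; first exact: unitmx1.
  by move=> p /negPf np; rewrite invmx1 mul1mx mxendE dual_idemE np mul0r.
apply: colspan_sub => p pk; apply/memv_imgP; exists (col p 1%:M).
  exact: memvf.
apply/matrixP => q j; rewrite mxendE (ord1 j) dual_idemE !mxE.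
by have [->|_] := eqVneq q p; rewrite ?pk ?mul1r ?mulr0.
Qed.

(** * The spaces V_ij and their orthogonal parts in the basis [flagB] *)

Lemma Vsub_colspan i j : Vsub C D x i j = colspan (tensn flagB)
  (fun p => ((ndiff x p)%:Z <= i) && ((ndiff x1 p)%:Z <= j)).
Proof.
have flagS c (B : vmatrix C D X) (h : int) :
    (\sum_(k < D.+1 | (k%:Z <= h)%R) colspan B (fun p => ndiff c p == k))%VS
      = colspan B (fun p => (ndiff c p)%:Z <= h).
  rewrite colspan_sum; apply: eq_colspan => p; apply/existsP/idP => [[k]|ph].
    by case/andP=> kh /eqP->.
  exists (Ordinal (ndiff_leq c p : ndiff c p < D.+1)%N).
  by rewrite ph eqxx.
have [iB iBB] := flagB_inv; have [iB' iBB'] := eigB_inv.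
have delta_inv : kmul (kdiag (fun=> 1)) (kdiag (fun=> 1)) =2 kdiag (fun _ : X => 1 : C).
  by move=> a b; rewrite kmul_diagl mul1r.
rewrite /Vsub; under eq_bigr do rewrite limg_dual_idem.
under [X in (_ :&: X)%VS]eq_bigr do rewrite limg_idem.
rewrite !flagS // -tens_kdiag1.
have down h m n : (m <= n)%N -> n%:Z <= h -> m%:Z <= h by lia.
(* The standard basis and [flagB] share e_x at label [x], while [eigB] and [flagB] share the
   all-ones vector at label [x1]. So both flags move to [flagB], where they can be intersected. *)
rewrite (@colspan_flag C D X _ _ _ _ x (fun n => n%:Z <= i) delta_inv iBB) //; last 2 first.
- by move=> a; rewrite /kdiag /site (eq_sym x x1) (negPf x1x) eqxx mul0r subr0 mulr1.
- exact: down.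
rewrite (@colspan_flag C D X _ _ _ _ x1 (fun n => n%:Z <= j) iBB' iBB) //; last 2 first.
- by move=> a; rewrite /site eqxx.
- exact: down.
by rewrite colspanI // flagB_unit.
Qed.

(** Pairing with e_y - e_x1 takes the difference of the entries at [y] and [x1]; these agree for e_x
    and for the all-ones vector. *)
Lemma flagB_ortho y y' : y != x -> y != x1 -> (y' == x) || (y' == x1) ->
  \sum_b flagB b y * (flagB b y')^* = 0.
Proof.
move=> yx yx1 y'x; under eq_bigr do rewrite mulrC.
rewrite (sum_site _ _ (fun b => (flagB b y')^*)) (negPf yx1) yx mul1r.
apply/eqP; rewrite subr_eq0; apply/eqP; congr (_^*); rewrite /site.
case/orP: y'x => /eqP->; rewrite eqxx //.
by rewrite (eq_sym x x1) (negPf x1x) (negPf yx) eqxx !mul0r.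
Qed.

(** Inclusion-exclusion: no label equals both [x] and [x1]. In particular every basis tensor has i +
    j >= D. *)
Lemma ndiffD p : (ndiff x p + ndiff x1 p)%N =
  (D + #|[set k | (entry p k != x) && (entry p k != x1)]|)%N.
Proof.
rewrite /ndiff -cardsUI; congr (_ + _)%N.
  rewrite -[RHS]card_ord; apply: eq_card => k; rewrite !inE -negb_and.
  by apply: contra_neqN x1x => /andP[/eqP-> /eqP].
by apply: eq_card => k; rewrite !inE.
Qed.

Lemma ortho_flag i j p q :
  (ndiff x p == i) && (ndiff x1 p == j) ->
  (ndiff x q <= i)%N && (ndiff x1 q <= j)%N ->
  ~~ ((ndiff x q == i) && (ndiff x1 q == j)) ->
  hdot (col p (tensn flagB)) (col q (tensn flagB)) = 0.
Proof.
move=> pij qij qnij.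
(* By [ndiffD], [p] has more sites labelled outside {x, x1} than [q]. At a site [k] where only [p]
   has such a label, the one-site inner product vanishes. *)
have /subsetPn[k] : ~~ ([set k | (entry p k != x) && (entry p k != x1)]
    \subset [set k | (entry q k != x) && (entry q k != x1)]).
  apply/negP => /subset_leq_card.
  by have := ndiffD p; have := ndiffD q; lia.
rewrite !inE => /andP[px px1]; rewrite negb_and !negbK => qx.
rewrite hdot_col tens_tr tens_conj tens_mul mxE (bigD1 k) //=.
by rewrite [kmul _ _ _ _]flagB_ortho // mul0r.
Qed.

Lemma Vtilde_colspan (i j : nat) : Vtilde C D x i j =
  colspan (tensn flagB) (fun p => (ndiff x p == i) && (ndiff x1 p == j)).
Proof.
rewrite /Vtilde !Vsub_colspan colspanD.
rewrite -[RHS](@colspan_orthoD _ _ _ _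
  (fun p => (ndiff x p <= i)%N && (ndiff x1 p <= j)%N)) //; first last.
- by move=> p q; apply: ortho_flag.
- by move=> p /andP[/eqP-> /eqP->]; rewrite !leqnn.
(* The labels of V_(i-1,j) + V_(i,j-1) are those of V_ij for which one of the two inequalities is
   strict. *)
congr (_ :&: orthoC _)%VS; apply: eq_colspan => p //=.
by rewrite /predD /=; lia.
Qed.

(** * Diagonalisation of the commutator *)

Lemma commutator_eigen :
  let A := distmx C D X D in let As := dual_distmx C D x D in
  (invmx A *m invmx As *m A *m As) *m tensn flagB =
  tensn flagB *m diag_mx (\row_p \prod_k site_eigenvalue C x x1 (entry p k)).
Proof.
move=> A As; have r1 := card_neq1.
have AE : A = tensn (@neighbor C X) by apply: distmx_diameter.
have AsE : As = tensn (kdiag (dualsite C x)) by apply: dual_distmx_diameter.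
have uA : A \in unitmx.
  have [] := tens_inverse (fun _ : 'I_D => neighbor_inv r1).
  by rewrite AE.
have uAs : As \in unitmx.
  have dual_neq0 a : dualsite C x a != 0.
    rewrite /dualsite; case: (x == a); last by rewrite mulr0n mulr0 sub0r oppr_eq0 oner_eq0.
    by rewrite mulr1n mulr1 subr_eq0.
  have inv : kmul (kdiag (fun a => (dualsite C x a)^-1)) (kdiag (dualsite C x))
      =2 kdiag (fun=> 1).
    move=> a b; rewrite kmul_diagl /kdiag; have [->|_] := eqVneq a b.
      by rewrite !mul1r mulVf.
    by rewrite !mul0r mulr0.
  have [] := tens_inverse (fun _ : 'I_D => inv).
  by rewrite AsE.
rewrite -(tens_kdiag (fun=> site_eigenvalue C x x1)).
(* Moving both inverses to the other side leaves an identity of tensors, which is checked site by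
   site. *)
rewrite -!mulmxA; apply: (canLR (mulKmx uA)); apply: (canLR (mulKmx uAs)).
rewrite AE AsE !tens_mul.
by apply: eq_tens => k a b; apply: commutator_site.
Qed.

(** A site labelled [x] counts only in [ndiff x1] and one labelled [x1] only in [ndiff x], giving
    exponents 1 and -1; any other label counts in both and cancels. *)
Lemma prod_site_eigenvalue p :
  \prod_k site_eigenvalue C x x1 (entry p k)
    = (1 - r) ^ ((ndiff x1 p)%:Z - (ndiff x p)%:Z).
Proof.
have r10 : 1 - r != 0 by rewrite subr_eq0 eq_sym card_neq1.
rewrite expfzDr // -exprz_inv -!exprnP.
have ndiffE c : ndiff c p = (\sum_k (entry p k != c))%N.
  by rewrite /ndiff -sum1dep_card big_mkcond.
rewrite !ndiffE -!prodrXr -big_split /=; apply: eq_bigr => k _.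
rewrite /site_eigenvalue; have [->|kx] := eqVneq (entry p k) x.
  by rewrite eq_sym x1x expr0 mulr1.
by case: eqP => _ /=; rewrite !expr1 ?expr0 ?mul1r ?divff.
Qed.

Lemma eigenspace_commutator (s : int) :
  let A := distmx C D X D in let As := dual_distmx C D x D in
  passmx.leigenspace (mxend (invmx A *m invmx As *m A *m As)) ((1 - r) ^ s) =
  colspan (tensn flagB) (fun p => (ndiff x1 p)%:Z - (ndiff x p)%:Z == s).
Proof.
move=> A As.
rewrite (leigenspace_diag _ flagB_unit commutator_eigen).
apply: eq_colspan => p; rewrite mxE prod_site_eigenvalue.
apply/inj_eq/exprz_inj; rewrite distrC -[1]/(1%:R) -natrB ?normr_nat ?ltr1n //; lia.
Qed.

(** Choose the [i] sites with label other than [x], among them the [D - j] sites labelled [x1], and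
    then one of r - 2 labels at each of the remaining i + j - D sites. *)
Lemma card_ndiff (i j : nat) : (i <= D)%N -> (j <= D)%N -> (D <= i + j)%N ->
  #|[pred p : 'I_N | (ndiff x p == i) && (ndiff x1 p == j)]| =
  ('C(D, i) * 'C(i, D - j) * (#|X| - 2) ^ (i + j - D))%N.
Proof.
move=> iD jD Dij.
pose nx (f : {ffun 'I_D -> X}) := [set k | f k != x].
pose ex1 (f : {ffun 'I_D -> X}) := [set k | f k == x1].
have -> : #|[pred p : 'I_N | (ndiff x p == i) && (ndiff x1 p == j)]| =
    #|[pred f | (#|nx f| == i) && (#|ex1 f| == (D - j)%N)]|.
  rewrite -sum1_card -[RHS]sum1_card.
  rewrite [in RHS](reindex (fun p : 'I_N => enum_val p : {ffun 'I_D -> X})).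
    apply: eq_bigl => p; rewrite !inE; congr (_ && _).
    have := cardsC (ex1 (enum_val p)); rewrite card_ord.
    have -> : ~: ex1 (enum_val p) = [set k | entry p k != x1].
      by apply/setP => k; rewrite !inE.
    by rewrite -/(ndiff x1 p); have := ndiff_leq x1 p; lia.
  exact/onW_bij/enum_val_bij.
rewrite -sum1_card (partition_big nx (fun A => #|A| == i)) /=; last first.
  by move=> f /andP[].
rewrite -mulnA -[D in 'C(D, i)]card_ord -card_draws -sum_nat_cond_const.
apply: eq_bigr => A /eqP Ai.
rewrite (partition_big ex1 (fun B => (B \subset A) && (#|B| == D - j)%N)) /=; last first.
  move=> f /andP[/andP[_ ->] /eqP <-]; rewrite andbT; apply/subsetP => k.
  by rewrite !inE => /eqP->.
rewrite -[i in 'C(i, _)]Ai -cards_draws -sum_nat_cond_const.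
apply: eq_bigr => B /andP[BA /eqP Bj].
pose F k : pred X :=
  if k \in B then pred1 x1 else [pred y | (y != x) && (y != x1)].
(* With [A] and [B] fixed, the labellings take the value [x] off [A], [x1] on [B], and avoid both on
   the rest of [A]. *)
transitivity #|pfamily x (mem A) F|.
  rewrite sum1_card; apply: eq_card => f.
  change ((#|nx f| == i) && (#|ex1 f| == (D - j)%N) && (nx f == A) && (ex1 f == B)
    = (f \in pfamily x (mem A) F)).
  apply/idP/pfamilyP => [/andP[/andP[_ /eqP fA] /eqP fB]|[fA fF]].
    split=> [|k]; first by rewrite -fA; apply/subsetP => k; rewrite !inE.
    rewrite /F -fA -fB !inE => fkx.
    by case: (eqVneq (f k) x1) => fkx1; rewrite inE ?fkx1 ?fkx.
  have {}fA : nx f = A.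
    apply/setP => k; rewrite inE; apply/idP/idP => [|kA]; first exact: (subsetP fA).
    have := fF k kA; rewrite /F.
    by case: (k \in B); rewrite inE /=; [move/eqP-> | case/andP].
  have fB : ex1 f = B.
    apply/setP => k; rewrite inE; have [kA|kA] := boolP (k \in A).
      have := fF k kA; rewrite /F.
      by case: (k \in B); rewrite inE /=; [move-> | case/andP=> _ /negPf].
    rewrite (contraNF (subsetP BA k) kA).
    move: kA; rewrite -fA inE negbK => /eqP->.
    by rewrite eq_sym (negPf x1x).
  by rewrite fA fB Ai Bj !eqxx.
rewrite card_pfamily foldrE big_image /=.
transitivity (\prod_(k in A :\: B) (#|X| - 2))%N.
  rewrite big_mkcond [RHS]big_mkcond /=; apply: eq_bigr => k _; rewrite /F inE.
  have [kA|//] := boolP (k \in A); last by rewrite andbF.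
  have [kB|_] /= := boolP (k \in B); first by rewrite card1.
  have := cardC (pred2 x x1); rewrite card2 eq_sym x1x => <-.
  by rewrite addKn; apply: eq_card => y; rewrite !inE negb_or.
rewrite prod_nat_const cardsD (setIidPr BA) Ai Bj; congr (_ ^ _)%N; lia.
Qed.

End HammingGraph.

(** * Eigenspaces of the commutator and their dimensions *)

Theorem theorem32 (R : realType) (D r : nat) (hD : (1 <= D)%N) (hr : (3 <= r)%N)
  (X : finType) (hX : #|X| = r) (x : X)
  (s : int) (hs : - D%:Z <= s <= D%:Z) :
  let A := distmx R[i] D X D in
  let As := dual_distmx R[i] D x D in
  let M := mxend (invmx A *m invmx As *m A *m As) in
  let lambda : R[i] := (1 - r%:R) ^ s in
  let W := (\sum_(i < D.+1) \sum_(j < D.+1 | (D <= i + j)%N && (j%:Z - i%:Z == s)%R)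
              Vtilde R[i] D x i j)%VS in
  [/\ passmx.leigenvalue M lambda,
      W = passmx.leigenspace M lambda &
      \dim W = (\sum_(i < D.+1) \sum_(j < D.+1 | (D <= i + j) && (j%:Z - i%:Z == s)%R)
                  'C(D, i) * 'C(i, D - j) * (r - 2) ^ (i + j - D))%N].
Proof.
move=> A As M lambda W.
have X3 : (2 < #|X|)%N by rewrite hX.
have [x1 x1x] : exists x1, x1 != x.
  have /card_gt0P[x1] : (0 < #|predC1 x|)%N by rewrite cardC1; lia.
  by rewrite inE => x1x; exists x1.
pose T := [pred p : 'I_#|vertex D X| | (ndiff x1 p)%:Z - (ndiff x p)%:Z == s].
pose P := @tens R[i] D X (fun=> site (fun z => (z != x)%:R) x1).
have uP : P \in unitmx by apply: flagB_unit.
have ndiffDle (p : 'I_#|vertex D X|) : (D <= ndiff x p + ndiff x1 p)%N.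
  by rewrite ndiffD // leq_addr.
(* Each basis tensor has exactly one pair (i, j), and i + j >= D holds for it, so the double sum
   collects all labels with j - i = s. *)
have WE : W = colspan P T.
  rewrite /W; under eq_bigr => i _.
    under eq_bigr do rewrite (Vtilde_colspan _ _ X3 x1x).
    rewrite colspan_sum; over.
  rewrite colspan_sum; apply: eq_colspan => p /=.
  apply/existsP/idP => [[i /existsP[j]]|pT].
    by move=> /andP[/andP[_ ij] /andP[/eqP-> /eqP->]].
  exists (Ordinal (ndiff_leq x p : ndiff x p < D.+1)%N); apply/existsP.
  exists (Ordinal (ndiff_leq x1 p : ndiff x1 p < D.+1)%N).
  by rewrite /= ndiffDle !eqxx pT.
have WM : W = passmx.leigenspace M lambda.
  by rewrite WE /lambda -hX (eigenspace_commutator _ _ X3 x1x).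
have dimW : \dim W = (\sum_(i < D.+1)
    \sum_(j < D.+1 | (D <= i + j) && (j%:Z - i%:Z == s)%R)
      'C(D, i) * 'C(i, D - j) * (r - 2) ^ (i + j - D))%N.
  rewrite WE dim_colspan // -sum1_card.
  rewrite (partition_big (fun p => Ordinal (ndiff_leq x p : ndiff x p < D.+1)%N) predT) //.
  apply: eq_bigr => i _.
  rewrite (partition_big (fun p => Ordinal (ndiff_leq x1 p : ndiff x1 p < D.+1)%N)
    (fun j : 'I_D.+1 => (D <= i + j)%N && (j%:Z - i%:Z == s)%R)) /=; last first.
    by move=> p /andP[pT /eqP <-]; rewrite /= ndiffDle.
  apply: eq_bigr => j /andP[Dij ij].
  rewrite -hX -(card_ndiff X3 x1x) ?leq_ord // -[RHS]sum1_card; apply: eq_bigl => p.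
  rewrite !inE -!val_eqE /=.
  have [->|//] := eqVneq (ndiff x p) i; rewrite ?andbF //=.
  by have [->|//] := eqVneq (ndiff x1 p) j; rewrite ?andbF ?ij.
split=> //; rewrite /passmx.leigenvalue -WM -dimv_eq0 dimW -lt0n.
(* The eigenspace is nonzero because one summand of its dimension is positive: take (D - s, D) for s
   >= 0 and (D, D - |s|) for s < 0. The bound [D - j <= i] keeps the second binomial positive. *)
have [i [j [Dij ij]]] : exists i j : 'I_D.+1,
    [/\ (D <= i + j)%N, j%:Z - i%:Z == s & (D - j <= i)%N].
  have [s0|s0] := leP 0 s.
    have iD : (D - `|s| < D.+1)%N by lia.
    by exists (Ordinal iD), ord_max; split => /=; lia.
  have jD : (D - `|s| < D.+1)%N by lia.
  by exists ord_max, (Ordinal jD); split => /=; lia.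
move=> Dji; rewrite (bigD1 i) //= (bigD1 j) ?Dij //=.
rewrite !addn_gt0 !muln_gt0 !bin_gt0 Dji leq_ord expn_gt0.
by rewrite subn_gt0 hr.
Qed.
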